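(* Let $S$ be a regular elliptical surface with constant curvatures, i.e. such that $I_{40},I_{31},I_{22},I_{13},I_{04}$ are constant on $S$. Then, up to the action of $D_3$, the curvature $(I_{40},I_{31},I_{22},I_{13},I_{04})$ of $S$ has one of the following forms, with $k,l\in\mathbb{R}$: \begin{enumerate} \item $A^1_k=(k,0,-1,0,3)$, $A^2_k=(-3k^2+6k,\,0,\,-k^2-2k+2,\,0,\,-3k^2-6k)$ or $A^3_k=(k,0,k,0,-3k)$; \item $B_{k,l}=(k,\,l(2k-3),\,k,\,0,\,-3k)$, where $l(2k-3)>0$; \item $C_k=(k,\,\sqrt{k(3-k)},\,-k+2,\,-\sqrt{k(3-k)},\,k)$, where $0<k<3$. \end{enumerate}
   Context: $A^3$ is real affine 3-space; surfaces are smooth. A surface $S\subset A^3$ is called regular elliptical if for every $P\in S$ there is an affine frame $(e_1,e_2,e_3)$ (a basis of $\mathbb{R}^3$) with origin $P$ such that, in the affine coordinates $(x,y,z)\leftrightarrow P+xe_1+ye_2+ze_3$, $S$ is near $P$ the graph of a function with Taylor expansion $$z=\tfrac12(x^2+y^2)+\tfrac16(x^3-3xy^2)+\sum_{n\ge 4}\frac1{n!}\sum_{i+j=n}I_{ij}\binom{n}{i}x^iy^j .$$ A moving frame on $S$ is a smooth choice of such a frame (it always exists locally); the coefficients $I_{40},I_{31},I_{22},I_{13},I_{04}$ are then functions on $S$, called the fundamental curvature invariants. The frame at a point is unique up to the group $D_3$ (symmetry group of the equilateral triangle with vertices $(1,0),(-\frac12,\pm\frac{\sqrt3}2)$) generated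 by the coordinate changes $\sigma: x=-\frac12x'-\frac{\sqrt3}{2}y',\ y=\frac{\sqrt3}{2}x'-\frac12y',\ z=z'$ and $\tau: x=x',\ y=-y',\ z=z'$. The action of $D_3$ on 5-tuples $(I_{40},I_{31},I_{22},I_{13},I_{04})$ is the one induced by these coordinate changes on the quartic form $I_{40}x^4+4I_{31}x^3y+6I_{22}x^2y^2+4I_{13}xy^3+I_{04}y^4$.
   Formalization: In A^2_k the middle entry -k^2-2k+2 is corrected to -k^2+2k+2: the surface y^2+W(1+x)=W^{4/3}, W=1+3x+6z, near the origin has constant curvatures (0,0,2,0,-24), which is D_3-equivalent to no printed form. *)

(* Defs.v *)
From Stdlib Require Import Reals.
From Coquelicot Require Import Coquelicot.
Open Scope R_scope.

Definition space : Type := (R * R * R)%type.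

Record frame : Type := Frame { e1 : space; e2 : space; e3 : space }.

Definition lin_comb (e : frame) (x y z : R) : space :=
  plus (plus (scal x (e1 e)) (scal y (e2 e))) (scal z (e3 e)).

Definition is_basis (e : frame) : Prop :=
  forall v : space, exists! c : R * R * R,
    let '(x, y, z) := c in v = lin_comb e x y z.

Definition affine_point (P : space) (e : frame) (x y z : R) : space :=
  plus P (lin_comb e x y z).

(* C^oo on a neighbourhood of (x0, y0) that does not depend on the order. *)
Definition smooth_near (f : R -> R -> R) (x0 y0 : R) : Prop :=
  locally_2d (fun u v => forall n, ex_diff_n f n u v) x0 y0.

(* Near P, the set S is the graph z = f(x,y) in the affine coordinates with
   origin P and basis e.  Only the germ of f at (0,0) matters, and it is
   determined by S, P and e. *)
Definition local_graph (S : space -> Prop) (P : space) (e : frame)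
    (f : R -> R -> R) : Prop :=
  is_basis e /\ smooth_near f 0 0 /\
  locally (0, 0, 0) (fun q : R * R * R =>
    let '(x, y, z) := q in S (affine_point P e x y z) <-> z = f x y).

Definition smooth_surface (S : space -> Prop) : Prop :=
  (exists P, S P) /\
  forall P, S P -> exists e f, local_graph S P e f.

(* [DL_pol n f 0 0] is the Taylor polynomial of f of order n at (0,0). *)
Definition adapted (S : space -> Prop) (P : space) (e : frame)
    (f : R -> R -> R) : Prop :=
  local_graph S P e f /\
  forall x y : R,
    DL_pol 3 f 0 0 x y =
      1 / 2 * (x ^ 2 + y ^ 2) + 1 / 6 * (x ^ 3 - 3 * x * y ^ 2).

Definition adapted_frame (S : space -> Prop) (P : space) (e : frame) : Prop :=
  exists f, adapted S P e f.

Definition regular_elliptical (S : space -> Prop) : Prop :=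
  smooth_surface S /\ forall P, S P -> exists e, adapted_frame S P e.

Definition curvatures : Type := (R * R * R * R * R)%type.

(* (I40, I31, I22, I13, I04): since the term of degree n of the expansion is
   1/n! sum_{i+j=n} I_ij binom(n,i) x^i y^j, I_ij is d^(i+j) f / dx^i dy^j. *)
Definition taylor_curvatures (f : R -> R -> R) : curvatures :=
  (partial_derive 4 0 f 0 0, partial_derive 3 1 f 0 0,
   partial_derive 2 2 f 0 0, partial_derive 1 3 f 0 0,
   partial_derive 0 4 f 0 0).

Definition has_curvatures (S : space -> Prop) (P : space) (e : frame)
    (c : curvatures) : Prop :=
  exists f, adapted S P e f /\ c = taylor_curvatures f.

(* F need only be meaningful on S; its smoothness on the part of S in the open
   set U is that of its expression in the local graph parametrizations of S. *)
Definition smooth_on (S U : space -> Prop) (F : space -> R) : Prop :=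
  forall P, S P -> U P -> forall e f, local_graph S P e f ->
    smooth_near (fun x y => F (affine_point P e x y (f x y))) 0 0.

Definition smooth_vector_on (S U : space -> Prop) (F : space -> space) : Prop :=
  smooth_on S U (fun Q => fst (fst (F Q))) /\
  smooth_on S U (fun Q => snd (fst (F Q))) /\
  smooth_on S U (fun Q => snd (F Q)).

Definition moving_frame (S U : space -> Prop) (E : space -> frame) : Prop :=
  (forall Q, S Q -> U Q -> adapted_frame S Q (E Q)) /\
  smooth_vector_on S U (fun Q => e1 (E Q)) /\
  smooth_vector_on S U (fun Q => e2 (E Q)) /\
  smooth_vector_on S U (fun Q => e3 (E Q)).

(* Moving frames exist only locally in general, so constancy is expressed with
   local moving frames; the value c is the same for all of them. *)
Definition constant_curvatures (S : space -> Prop) (c : curvatures) : Prop :=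
  forall P, S P ->
    exists U : space -> Prop, open U /\ U P /\
      exists E, moving_frame S U E /\
        forall Q, S Q -> U Q -> has_curvatures S Q (E Q) c.

(* The generators of D3 as coordinate changes (x',y') |-> (x,y); z = z'. *)
Definition sigma (p : R * R) : R * R :=
  let '(x', y') := p in
  (- (1 / 2) * x' - sqrt 3 / 2 * y', sqrt 3 / 2 * x' - 1 / 2 * y').

Definition tau (p : R * R) : R * R := let '(x', y') := p in (x', - y').

(* sigma and tau have finite order, so no closure under inverses is needed. *)
Inductive D3 : (R * R -> R * R) -> Prop :=
| D3_id : D3 (fun p => p)
| D3_sigma g : D3 g -> D3 (fun p => sigma (g p))
| D3_tau g : D3 g -> D3 (fun p => tau (g p)).

Definition quartic_form (c : curvatures) (p : R * R) : R :=
  let '(i40, i31, i22, i13, i04) := c in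
  let '(x, y) := p in
  i40 * x ^ 4 + 4 * i31 * x ^ 3 * y + 6 * i22 * x ^ 2 * y ^ 2
  + 4 * i13 * x * y ^ 3 + i04 * y ^ 4.

Definition D3_equiv (c c' : curvatures) : Prop :=
  exists g, D3 g /\ forall p, quartic_form c' p = quartic_form c (g p).

Definition curvA1 (k : R) : curvatures := (k, 0, - 1, 0, 3).

(* The source prints -k^2-2k+2 in the middle, a misprint: near the origin, the
   surface y^2 + W (1+x) = W^(4/3) with W = 1+3x+6z has the constant curvatures
   (0,0,2,0,-24), the case k = 2 below, which no D3 element brings to one of
   the forms obtained with the printed sign. *)
Definition curvA2 (k : R) : curvatures :=
  (- 3 * k ^ 2 + 6 * k, 0, - k ^ 2 + 2 * k + 2, 0, - 3 * k ^ 2 - 6 * k).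

Definition curvA3 (k : R) : curvatures := (k, 0, k, 0, - 3 * k).

Definition curvB (k l : R) : curvatures :=
  (k, l * (2 * k - 3), k, 0, - 3 * k).

Definition curvC (k : R) : curvatures :=
  (k, sqrt (k * (3 - k)), - k + 2, - sqrt (k * (3 - k)), k).

(* Main.v *)
Require Import Defs.
From Stdlib Require Import Reals Lra Lia.
From Coquelicot Require Import Coquelicot.
Open Scope R_scope.

(** Fix a point of the surface, write the surface as z = f(x,y) in the moving
    frame at this point, and let m(s,t) be the matrix of the moving frame at
    (s,t,f(s,t)).  Constancy of the curvatures says that f, re-expanded in the
    frame m(s,t), has the same normalized 4-jet for all (s,t).  Comparing
    derivatives of order at most 4 along all lines through the new origin, and
    then differentiating once in s and once in t at (0,0), gives linear
    equations.  Orders 2 and 3 determine the first derivatives of m in terms of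
    the curvatures, order 4 determines the 5-jet of f twice, and the agreement
    of the mixed fifth derivatives amounts to four quadratic equations in the
    curvatures.

    To solve them, write the quartic form as
    alpha |z|^4 + Re (beta z^2) |z|^2 + Re (gamma z^4) with z = x + iy.  The
    equations become Im (beta gamma) = 0,
    |beta|^2 - 8 |gamma|^2 - 2 Re (beta gamma) + 12 alpha = 0 and
    (alpha - 3) conj beta + (4 alpha - 6) gamma = beta^2 + 2 beta conj gamma.
    If beta = 0, either alpha = gamma = 0 or alpha = 3/2 and |gamma| = 3/2 (type
    C).  Otherwise gamma = t conj beta with t real, and either beta^3 is real,
    so that a rotation in D3 makes beta and gamma real (type A), or t = -1/2 and
    alpha = 0 (types B and A3). *)

(** * The algebraic classification *)

(* [beta = b1 + i b2] and [gamma = g1 + i g2]. *)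
Definition harmonic (al b1 b2 g1 g2 : R) : curvatures :=
  (al + b1 + g1, - b2 / 2 - g2, al / 3 - g1, - b2 / 2 + g2, al - b1 + g1).

Lemma curvatures_eq (a b c d e a' b' c' d' e' : R) :
  a = a' -> b = b' -> c = c' -> d = d' -> e = e' ->
  (a, b, c, d, e) = (a', b', c', d', e').
Proof. congruence. Qed.

Lemma sqr_sqrt3 : sqrt 3 * sqrt 3 = 3.
Proof. apply sqrt_sqrt; lra. Qed.

Lemma D3_comp g h : D3 g -> D3 h -> D3 (fun p => g (h p)).
Proof.
intros Hg Hh; induction Hg as [|g Hg IH|g Hg IH].
- exact Hh.
- exact (D3_sigma _ IH).
- exact (D3_tau _ IH).
Qed.

Lemma D3_equiv_trans c1 c2 c3 : D3_equiv c1 c2 -> D3_equiv c2 c3 -> D3_equiv c1 c3.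
Proof.
intros [g [Hg E1]] [h [Hh E2]].
exists (fun p => g (h p)); split; [now apply D3_comp|].
intros p; now rewrite E2, E1.
Qed.

Lemma D3_equiv_refl c : D3_equiv c c.
Proof. exists (fun p => p); split; [constructor|reflexivity]. Qed.

(** [tau] is the conjugation of z, so it conjugates beta and gamma and fixes alpha. *)
Lemma harmonic_tau al b1 b2 g1 g2 :
  D3_equiv (harmonic al b1 b2 g1 g2) (harmonic al b1 (- b2) g1 (- g2)).
Proof.
exists (fun p => tau p); split; [apply D3_tau, D3_id|].
intros [x y]; unfold quartic_form, harmonic, tau; field.
Qed.

(** [sigma] reads z = w z' with w = exp(2 i pi / 3), so beta is multiplied by w^2 = conj w and gamma
    by w^4 = w. *)
Lemma harmonic_sigma al b1 b2 g1 g2 :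
  D3_equiv (harmonic al b1 b2 g1 g2)
    (harmonic al (- b1 / 2 + sqrt 3 / 2 * b2) (- b2 / 2 - sqrt 3 / 2 * b1)
       (- g1 / 2 - sqrt 3 / 2 * g2) (- g2 / 2 + sqrt 3 / 2 * g1)).
Proof.
exists (fun p => Defs.sigma p); split; [apply D3_sigma, D3_id|].
intros [x y]; unfold quartic_form, harmonic, Defs.sigma.
pose proof sqr_sqrt3 as H; set (r := sqrt 3) in *.
assert (H2 : r ^ 2 = 3) by (simpl; lra).
assert (H3 : r ^ 3 = 3 * r) by (simpl; rewrite Rmult_1_r, H; ring).
assert (H4 : r ^ 4 = 9) by (replace (r ^ 4) with ((r ^ 2) ^ 2) by ring; rewrite H2; ring).
field_simplify; rewrite ?H2, ?H3, ?H4; field.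
Qed.

Definition classified (c : curvatures) : Prop :=
  exists c' : curvatures, D3_equiv c c' /\
      ((exists k : R, c' = curvA1 k \/ c' = curvA2 k \/ c' = curvA3 k) \/
       (exists k l : R, l * (2 * k - 3) > 0 /\ c' = curvB k l) \/
       (exists k : R, 0 < k < 3 /\ c' = curvC k)).

Lemma classified_D3 c1 c2 : D3_equiv c1 c2 -> classified c2 -> classified c1.
Proof.
intros H [c' [H' K]]; exists c'; split; [exact (D3_equiv_trans _ _ _ H H')|exact K].
Qed.

(** The last two conjuncts are the real and imaginary parts of a single complex equation. *)
Definition harmonic_compat (al b1 b2 g1 g2 : R) : Prop :=
  b1 * g2 + b2 * g1 = 0 /\
  b1 ^ 2 + b2 ^ 2 - 8 * (g1 ^ 2 + g2 ^ 2) - 2 * (b1 * g1 - b2 * g2) + 12 * al = 0 /\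
  (al - 3) * b1 + (4 * al - 6) * g1 = b1 ^ 2 - b2 ^ 2 + 2 * (b1 * g1 + b2 * g2) /\
  - (al - 3) * b2 + (4 * al - 6) * g2 = 2 * b1 * b2 + 2 * (b2 * g1 - b1 * g2).

Lemma classified_real al b1 g1 :
  harmonic_compat al b1 0 g1 0 -> classified (harmonic al b1 0 g1 0).
Proof.
intros (_ & H1 & H2 & _).
(* The second equation plus twice the third one factors. The first factor vanishes exactly when I04
   = -3 I22. *)
assert (K1 : (2 * al - b1 - 2 * g1) * (b1 + 4 * g1 + 6) = 0) by lra.
assert (K2 : b1 ^ 2 - 8 * g1 ^ 2 - 2 * (b1 * g1) + 12 * al = 0) by lra.
eexists; split; [apply D3_equiv_refl|left].
apply Rmult_integral in K1 as [K1|K1].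
(* Up to the factor 2 this is (I22 - I40) (I22 + 1) = 0, which separates A3 from A1. *)
- assert (K3 : (2 * (al / 3 - g1 - (al + b1 + g1))) * (al / 3 - g1 + 1) = 0).
  { assert (b1 = 2 * al - 2 * g1) by lra; subst b1; lra. }
  apply Rmult_integral in K3 as [K3|K3].
  + exists (al + b1 + g1); right; right; unfold harmonic, curvA3; apply curvatures_eq; lra.
  + exists (al + b1 + g1); left; unfold harmonic, curvA1; apply curvatures_eq; lra.
(* On A2 the combination 3 I22 - I04 equals 12 k + 6, which gives k. *)
- set (u := 3 * (al / 3 - g1) - (al - b1 + g1)).
  exists ((u - 6) / 12); right; left; unfold harmonic, curvA2, u.
  assert (b1 = - 4 * g1 - 6) by lra; subst b1.
  apply curvatures_eq; nra.
Qed.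

Lemma classified_tau al b1 b2 g1 g2 :
  classified (harmonic al b1 (- b2) g1 (- g2)) -> classified (harmonic al b1 b2 g1 g2).
Proof. apply classified_D3, harmonic_tau. Qed.

(** Here beta and gamma are real multiples of exp(-i pi / 3) and exp(i pi / 3). By [harmonic_sigma]
    they are turned by -2 pi / 3 and 2 pi / 3, hence become -2 b1 and -2 g1, and the real case
    applies. *)
Lemma classified_rotated al b1 g1 :
  harmonic_compat al b1 (- sqrt 3 * b1) g1 (sqrt 3 * g1) ->
  classified (harmonic al b1 (- sqrt 3 * b1) g1 (sqrt 3 * g1)).
Proof.
pose proof sqr_sqrt3 as H.
intros (_ & H1 & H2 & _).
eapply classified_D3; [apply harmonic_sigma|].
set (r := sqrt 3) in *.
replace (- b1 / 2 + r / 2 * (- r * b1)) with (- (1 / 2) * b1 - 1 / 2 * (r * r) * b1) by field.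
replace (- (- r * b1) / 2 - r / 2 * b1) with 0 by field.
replace (- g1 / 2 - r / 2 * (r * g1)) with (- (1 / 2) * g1 - 1 / 2 * (r * r) * g1) by field.
replace (- (r * g1) / 2 + r / 2 * g1) with 0 by field.
replace ((- r * b1) ^ 2) with ((r * r) * b1 ^ 2) in * by ring.
replace ((r * g1) ^ 2) with ((r * r) * g1 ^ 2) in * by ring.
replace ((- r * b1) * (r * g1)) with (- (r * r) * (b1 * g1)) in * by ring.
rewrite H in *.
apply classified_real; repeat split; nra.
Qed.

(** These curvatures are (k, -b2, k, 0, -3k) with k = b1 / 2. If 2k - 3 is nonzero, the sign of b2
    decides: B for b2 < 0, A3 for b2 = 0, and [tau] reduces b2 > 0 to b2 < 0. On the line b1 = 3 no
    l exists, and an element of D3 first moves beta off that line. *)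
Lemma classified_B_plane b1 b2 :
  classified (harmonic 0 b1 b2 (- b1 / 2) (b2 / 2)).
Proof.
assert (K : forall x y, x <> 3 -> classified (harmonic 0 x y (- x / 2) (y / 2))).
{ assert (K' : forall x y, x <> 3 -> y < 0 -> classified (harmonic 0 x y (- x / 2) (y / 2))).
  { intros x y Hx Hy; eexists; split; [apply D3_equiv_refl|right; left].
    exists (x / 2), (- y / (2 * (x / 2) - 3)).
    assert (E : - y / (2 * (x / 2) - 3) * (2 * (x / 2) - 3) = - y) by (field; lra).
    unfold curvB; rewrite E; split; [lra|].
    unfold harmonic; apply curvatures_eq; field. }
  intros x y Hx; destruct (Rtotal_order y 0) as [Hy|[Hy|Hy]].
  - now apply K'.
  - subst y; eexists; split; [apply D3_equiv_refl|left].
    exists (x / 2); right; right; unfold harmonic, curvA3; apply curvatures_eq; field.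
  - apply classified_tau; replace (- (y / 2)) with (- y / 2) by field.
    apply K'; lra. }
(* After [sigma] the first coordinate of beta is 3 exactly when x - sqrt 3 * y = -6. *)
assert (K2 : forall x y, x - sqrt 3 * y <> - 6 -> 
   classified (harmonic 0 x y (- x / 2) (y / 2))).
{ intros x y Hx; eapply classified_D3; [apply harmonic_sigma|].
  replace (- (- x / 2) / 2 - sqrt 3 / 2 * (y / 2))
    with (- (- x / 2 + sqrt 3 / 2 * y) / 2) by field.
  replace (- (y / 2) / 2 + sqrt 3 / 2 * (- x / 2))
    with ((- y / 2 - sqrt 3 / 2 * x) / 2) by field.
  apply K; lra. }
destruct (Req_dec (b1 - sqrt 3 * b2) (- 6)) as [E|E]; [|now apply K2].
destruct (Req_dec b1 3) as [E1|E1]; [|now apply K].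
(* Only beta = 3 + 3 sqrt 3 i lies on both exceptional lines; its conjugate is off the second
   one. *)
apply classified_tau; replace (- (b2 / 2)) with (- b2 / 2) by field.
apply K2; lra.
Qed.

(** With k = g1 + 3/2 the circle reads g2^2 = k (3 - k), so g2 < 0 is type C. The endpoints k = 0
    and k = 3 have g2 = 0 and fall under the real case; [tau] exchanges the two open
    half-circles. *)
Lemma classified_C_circle g1 g2 :
  g1 ^ 2 + g2 ^ 2 = 9 / 4 -> classified (harmonic (3 / 2) 0 0 g1 g2).
Proof.
assert (K : forall y, g1 ^ 2 + y ^ 2 = 9 / 4 -> y < 0 ->
  classified (harmonic (3 / 2) 0 0 g1 y)).
{ intros y H Hy; eexists; split; [apply D3_equiv_refl|right; right].
  exists (g1 + 3 / 2).
  assert (E : sqrt ((g1 + 3 / 2) * (3 - (g1 + 3 / 2))) = - y).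
  { replace ((g1 + 3 / 2) * (3 - (g1 + 3 / 2))) with ((- y) ^ 2) by nra.
    apply sqrt_pow2; lra. }
  split; [split; nra|].
  unfold curvC; rewrite E; unfold harmonic; apply curvatures_eq; field. }
intros H; destruct (Rtotal_order g2 0) as [Hy|[Hy|Hy]].
- now apply K.
- subst g2; apply classified_real; repeat split; nra.
- apply classified_tau; rewrite Ropp_0; apply K; nra.
Qed.

Lemma classified_harmonic al b1 b2 g1 g2 :
  harmonic_compat al b1 b2 g1 g2 -> classified (harmonic al b1 b2 g1 g2).
Proof.
intros H; pose proof H as (H1 & H2 & H3 & H4).
destruct (Req_dec (b1 ^ 2 + b2 ^ 2) 0) as [N|N].
- assert (b1 = 0) by nra; assert (b2 = 0) by nra; subst b1 b2.
  destruct (Req_dec al (3 / 2)) as [->|Ha].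
  + apply classified_C_circle; lra.
  + assert (g1 = 0) by (apply (Rmult_eq_reg_l (4 * al - 6)); lra).
    assert (g2 = 0) by (apply (Rmult_eq_reg_l (4 * al - 6)); lra).
    subst g1 g2; now apply classified_real.
- (* [Im (beta gamma) = 0] makes [gamma] a real multiple of [conj beta]. *)
  set (t := (b1 * g1 - b2 * g2) / (b1 ^ 2 + b2 ^ 2)).
  assert (Ht : t * (b1 ^ 2 + b2 ^ 2) = b1 * g1 - b2 * g2) by (unfold t; now field).
  clearbody t.
  assert (E1 : g1 = t * b1).
  { apply (Rmult_eq_reg_r (b1 ^ 2 + b2 ^ 2)); [|exact N].
    apply (f_equal (Rmult b1)) in Ht; apply (f_equal (Rmult b2)) in H1; lra. }
  assert (E2 : g2 = - t * b2).
  { apply (Rmult_eq_reg_r (b1 ^ 2 + b2 ^ 2)); [|exact N].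
    apply (f_equal (Rmult b2)) in Ht; apply (f_equal (Rmult b1)) in H1; lra. }
  clear Ht; subst g1 g2.
  (* With gamma = t conj beta the complex equation is (al - 3 + t (4 al - 6)) conj beta = (1 + 2 t)
     beta^2. Multiplied by beta its left side is real, so (1 + 2 t) Im (beta^3) = 0. *)
  assert (K : (1 + 2 * t) * (b2 * (3 * b1 ^ 2 - b2 ^ 2)) = 0).
  { apply (f_equal (Rmult b2)) in H3; apply (f_equal (Rmult b1)) in H4; lra. }
  apply Rmult_integral in K as [K|K].
  + assert (t = - (1 / 2)) by lra; subst t.
    (* For t = -1/2 the same equation reduces to al conj beta = 0. *)
    assert (al = 0).
    { apply (Rmult_eq_reg_r (b1 ^ 2 + b2 ^ 2)); [|exact N].
      apply (f_equal (Rmult b1)) in H3; apply (f_equal (Rmult b2)) in H4; lra. }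
    subst al.
    replace (- (1 / 2) * b1) with (- b1 / 2) by field.
    replace (- - (1 / 2) * b2) with (b2 / 2) by field.
    apply classified_B_plane.
  + apply Rmult_integral in K as [K|K].
    * subst b2; replace (- t * 0) with 0 in * by ring; now apply classified_real.
    * pose proof sqr_sqrt3 as S3.
      (* The two lines b2 = - sqrt 3 * b1 and b2 = sqrt 3 * b1 are exchanged by [tau]. *)
      assert (K' : (b2 + sqrt 3 * b1) * (b2 - sqrt 3 * b1) = 0) by nra.
      apply Rmult_integral in K' as [K'|K'].
      -- assert (b2 = - sqrt 3 * b1) by lra; subst b2.
         replace (- t * (- sqrt 3 * b1)) with (sqrt 3 * (t * b1)) in * by ring.
         now apply classified_rotated.
      -- assert (b2 = sqrt 3 * b1) by lra; subst b2.
         apply classified_tau.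
         replace (- (sqrt 3 * b1)) with (- sqrt 3 * b1) by ring.
         replace (- (- t * (sqrt 3 * b1))) with (sqrt 3 * (t * b1)) by ring.
         apply classified_rotated.
         repeat split; lra.
Qed.

Lemma classified_of_compat a b c d e :
  3 * a * b - 15 * b * c + 3 * c * d + 17 * a * d - 4 * b * e - 36 * d = 0 ->
  - 9 * c ^ 2 + 3 * a * c + 10 * b * d + 2 * d ^ 2 - 3 * c * e + a * e + 18 * c + 6 * e = 0 ->
  3 * c * d + 6 * a * d - 3 * b * c - b * e - d * e - 12 * d = 0 ->
  - 12 * c * e + 6 * a * e + 6 * b * d + 14 * d ^ 2 - 18 * a + 18 * c - 9 * c ^ 2 - e ^ 2 = 0 ->
  classified (a, b, c, d, e).
Proof.
intros E1 E2 E3 E4.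
(* The arguments of [harmonic] are the components of the quartic form of angular frequency 0, 2 and
   4. *)
replace (a, b, c, d, e) with
  (harmonic (3 * (a + e + 2 * c) / 8) ((a - e) / 2) (- (b + d)) ((a + e - 6 * c) / 8) ((d - b) / 2))
  by (unfold harmonic; apply curvatures_eq; field).
apply classified_harmonic; repeat split; nra.
Qed.
(** * Derivatives of a function of two variables along a curve *)

(* The k-th derivative of [f (X r) (Y r)] in terms of the partial derivatives
   [p i j] of [f] and the derivatives [x i], [y i] of [X], [Y]. *)
Definition faa_di_bruno (k : nat) (p : nat -> nat -> R) (x y : nat -> R) : R :=
  match k with
  | 0 => p 0%nat 0%nat
  | 1 => p 1%nat 0%nat * x 1%nat + p 0%nat 1%nat * y 1%nat
  | 2 => p 2%nat 0%nat * x 1%nat ^ 2 + 2 * p 1%nat 1%nat * x 1%nat * y 1%nat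
         + p 0%nat 2%nat * y 1%nat ^ 2
         + p 1%nat 0%nat * x 2%nat + p 0%nat 1%nat * y 2%nat
  | 3 => p 3%nat 0%nat * x 1%nat ^ 3 + 3 * p 2%nat 1%nat * x 1%nat ^ 2 * y 1%nat
         + 3 * p 1%nat 2%nat * x 1%nat * y 1%nat ^ 2 + p 0%nat 3%nat * y 1%nat ^ 3
         + 3 * (p 2%nat 0%nat * x 1%nat * x 2%nat
                + p 1%nat 1%nat * (x 1%nat * y 2%nat + x 2%nat * y 1%nat)
                + p 0%nat 2%nat * y 1%nat * y 2%nat)
         + p 1%nat 0%nat * x 3%nat + p 0%nat 1%nat * y 3%nat
  | _ => p 4%nat 0%nat * x 1%nat ^ 4 + 4 * p 3%nat 1%nat * x 1%nat ^ 3 * y 1%nat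
         + 6 * p 2%nat 2%nat * x 1%nat ^ 2 * y 1%nat ^ 2
         + 4 * p 1%nat 3%nat * x 1%nat * y 1%nat ^ 3 + p 0%nat 4%nat * y 1%nat ^ 4
         + 6 * (p 3%nat 0%nat * x 1%nat ^ 2 * x 2%nat
                + p 2%nat 1%nat * (x 1%nat ^ 2 * y 2%nat + 2 * x 1%nat * y 1%nat * x 2%nat)
                + p 1%nat 2%nat * (2 * x 1%nat * y 1%nat * y 2%nat + y 1%nat ^ 2 * x 2%nat)
                + p 0%nat 3%nat * y 1%nat ^ 2 * y 2%nat)
         + 3 * (p 2%nat 0%nat * x 2%nat ^ 2 + 2 * p 1%nat 1%nat * x 2%nat * y 2%nat
                + p 0%nat 2%nat * y 2%nat ^ 2)
         + 4 * (p 2%nat 0%nat * x 1%nat * x 3%nat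
                + p 1%nat 1%nat * (x 1%nat * y 3%nat + x 3%nat * y 1%nat)
                + p 0%nat 2%nat * y 1%nat * y 3%nat)
         + p 1%nat 0%nat * x 4%nat + p 0%nat 1%nat * y 4%nat
  end.


(** Each formula is polynomial in the jets, so the product rule suffices once the chain rule is
    known for every [p i j]. The bound on k matters: from 4 on, [faa_di_bruno] always returns the
    order 4 formula. *)
Lemma is_derive_faa_di_bruno (k : nat) (p : nat -> nat -> R -> R) (x y : nat -> R -> R) (r : R) :
  (k < 4)%nat ->
  (forall i j, is_derive (p i j) r (p (S i) j r * x 1%nat r + p i (S j) r * y 1%nat r)) ->
  (forall i, (i < 4)%nat -> is_derive (x i) r (x (S i) r)) ->
  (forall i, (i < 4)%nat -> is_derive (y i) r (y (S i) r)) ->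
  is_derive (fun r => faa_di_bruno k (fun i j => p i j r) (fun i => x i r) (fun i => y i r)) r
    (faa_di_bruno (S k) (fun i j => p i j r) (fun i => x i r) (fun i => y i r)).
Proof.
intros Hk Hp Hx Hy.
assert (Dp : forall i j, Derive (fun r => p i j r) r = p (S i) j r * x 1%nat r + p i (S j) r * y 1%nat r)
  by (intros i j; apply is_derive_unique, Hp).
assert (Dx : forall i, (i < 4)%nat -> Derive (fun r => x i r) r = x (S i) r)
  by (intros i Hi; apply is_derive_unique, Hx, Hi).
assert (Dy : forall i, (i < 4)%nat -> Derive (fun r => y i r) r = y (S i) r)
  by (intros i Hi; apply is_derive_unique, Hy, Hi).
assert (Ep : forall i j, ex_derive (fun r => p i j r) r) by (intros i j; eexists; apply Hp).
assert (Ex : forall i, (i < 4)%nat -> ex_derive (fun r => x i r) r)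
  by (intros i Hi; eexists; apply Hx, Hi).
assert (Ey : forall i, (i < 4)%nat -> ex_derive (fun r => y i r) r)
  by (intros i Hi; eexists; apply Hy, Hi).
destruct k as [|[|[|[|k]]]]; [| | | |lia]; unfold faa_di_bruno; auto_derive;
  repeat match goal with
  | |- _ /\ _ => split
  | |- True => exact I
  | |- ex_derive (fun _ => p _ _ _) _ => apply Ep
  | |- ex_derive (fun _ => x _ _) _ => apply Ex; lia
  | |- ex_derive (fun _ => y _ _) _ => apply Ey; lia
  | |- _ = _ => rewrite ?Dp, ?Dx, ?Dy by lia; ring
  end.
Qed.

Lemma is_derive_locally_eq (f g : R -> R) (x l l' : R) :
  locally x (fun y => f y = g y) -> is_derive f x l -> is_derive g x l' -> l = l'.
Proof.
intros E Hf Hg; apply (is_derive_ext_loc _ _ _ _ E) in Hf.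
apply is_derive_unique in Hf; apply is_derive_unique in Hg; congruence.
Qed.

(** Differentiability at a point follows from a continuous x-derivative nearby and a y-derivative at
    the point. *)
Lemma smooth_near_differentiable (f : R -> R -> R) (x y : R) :
  smooth_near f x y ->
  locally_2d (fun u v => forall i j,
    differentiable_pt_lim (partial_derive i j f) u v
      (partial_derive (S i) j f u v) (partial_derive i (S j) f u v)) x y.
Proof.
intros Hf.
apply locally_2d_impl_strong with (2 := Hf); apply locally_2d_forall.
intros u v Huv i j.
assert (Hn : forall n, locally_2d (ex_diff_n f n) u v).
{ intros n; apply locally_2d_impl with (2 := Huv); apply locally_2d_forall; auto. }
apply filterdiff_differentiable_pt_lim.
eapply filterdiff_ext_lin.
- apply (is_derive_filterdiff (partial_derive i j f) u v
    (partial_derive (S i) j f) (partial_derive i (S j) f u v)).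
  + apply (locally_2d_locally (fun a b => is_derive (fun z => partial_derive i j f z b) a
      (partial_derive (S i) j f a b))).
    apply locally_2d_impl with (2 := Hn (S (i + j))); apply locally_2d_forall.
    intros a b H; apply Derive_correct, (ex_diff_n_ex_deriv_inf_1 (S (i + j))); [lia|exact H].
  (* [partial_derive] differentiates in y first, so adding one more y-derivative requires commuting
     it with the x-derivatives. *)
  + rewrite <- Derive_partial_derive by apply Hn.
    apply Derive_correct, (ex_diff_n_ex_deriv_inf_2 (S (i + j))); [lia|].
    apply (locally_2d_singleton _ _ _ (Hn _)).
  + apply continuity_2d_pt_filterlim, (ex_diff_n_continuity_inf_1 (S (i + j)) i j); [lia|].
    apply (locally_2d_singleton _ _ _ (Hn _)).
- intros [a b]; reflexivity.
Qed.

Lemma is_derive_partial_x (f : R -> R -> R) (x y lx ly : R) :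
  differentiable_pt_lim f x y lx ly -> is_derive (fun s => f s y) x lx.
Proof.
intros H; apply is_derive_Reals; replace lx with (lx * 1 + ly * 0) by ring.
apply (derivable_pt_lim_comp_2d f id (fct_cte y) x); [exact H| |].
- apply derivable_pt_lim_id.
- apply derivable_pt_lim_const.
Qed.

Lemma is_derive_partial_y (f : R -> R -> R) (x y lx ly : R) :
  differentiable_pt_lim f x y lx ly -> is_derive (fun t => f x t) y ly.
Proof.
intros H; apply is_derive_Reals; replace ly with (lx * 0 + ly * 1) by ring.
apply (derivable_pt_lim_comp_2d f (fct_cte x) id y); [exact H| |].
- apply derivable_pt_lim_const.
- apply derivable_pt_lim_id.
Qed.

Lemma locally_2d_pullback (P : R -> R -> Prop) (X Y : R -> R) (r : R) :
  locally_2d P (X r) (Y r) -> continuous X r -> continuous Y r ->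
  locally r (fun s => P (X s) (Y s)).
Proof.
intros [d Hd] HX HY.
assert (LX := HX _ (locally_ball (X r) d)); assert (LY := HY _ (locally_ball (Y r) d)).
apply (filter_imp (fun s => ball (X r) d (X s) /\ ball (Y r) d (Y s))).
- intros s [Bx By]; exact (Hd _ _ Bx By).
- now apply filter_and.
Qed.

(** The induction carries equality on a neighbourhood of x rather than at x alone, which allows the
    next differentiation. *)
Lemma derivative_sequences_agree (h k : nat -> R -> R) (n : nat) (x : R) :
  locally x (fun y => forall i, (i < n)%nat -> is_derive (h i) y (h (S i) y)) ->
  locally x (fun y => forall i, (i < n)%nat -> is_derive (k i) y (k (S i) y)) ->
  locally x (fun y => h 0%nat y = k 0%nat y) ->
  forall i, (i <= n)%nat -> h i x = k i x.
Proof.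
intros Hh Hk H0 i Hi; apply (locally_singleton _ (fun y => h i y = k i y)).
induction i as [|i IH]; [exact H0|].
assert (IH' := locally_locally _ _ (IH ltac:(lia))).
generalize (filter_and _ _ IH' (filter_and _ _ Hh Hk)).
apply filter_imp; intros y (E & Dh & Dk).
exact (is_derive_locally_eq _ _ _ _ _ E (Dh i Hi) (Dk i Hi)).
Qed.

Definition ray_jet (a : R) (k : nat) (r : R) : R :=
  match k with 0 => a * r | 1 => a | _ => 0 end.

Lemma is_derive_ray_jet (a : R) (k : nat) (r : R) :
  is_derive (ray_jet a k) r (ray_jet a (S k) r).
Proof. destruct k as [|[|k]]; unfold ray_jet; auto_derive; trivial; ring. Qed.

Definition composed_jet (f : R -> R -> R) (X Y : nat -> R -> R) (k : nat) (r : R) : R :=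
  faa_di_bruno k (fun i j => partial_derive i j f (X 0%nat r) (Y 0%nat r))
    (fun i => X i r) (fun i => Y i r).

Lemma is_derive_composed_jet (f : R -> R -> R) (X Y : nat -> R -> R) (r : R) :
  locally_2d (fun u v => forall i j,
    differentiable_pt_lim (partial_derive i j f) u v
      (partial_derive (S i) j f u v) (partial_derive i (S j) f u v))
    (X 0%nat r) (Y 0%nat r) ->
  locally r (fun s => forall i, (i < 4)%nat -> is_derive (X i) s (X (S i) s)) ->
  locally r (fun s => forall i, (i < 4)%nat -> is_derive (Y i) s (Y (S i) s)) ->
  locally r (fun s => forall i, (i < 4)%nat ->
    is_derive (composed_jet f X Y i) s (composed_jet f X Y (S i) s)).
Proof.
intros Hf HX HY.
assert (CX : continuous (X 0%nat) r).
{ apply @ex_derive_continuous; eexists; apply (locally_singleton _ _ HX); lia. }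
assert (CY : continuous (Y 0%nat) r).
{ apply @ex_derive_continuous; eexists; apply (locally_singleton _ _ HY); lia. }
generalize (filter_and _ _ (locally_2d_pullback _ _ _ _ Hf CX CY) (filter_and _ _ HX HY)).
apply filter_imp; intros s (Df & DX & DY) k Hk.
apply (is_derive_faa_di_bruno k (fun i j r => partial_derive i j f (X 0%nat r) (Y 0%nat r)) X Y);
  auto.
intros i j; apply is_derive_Reals, derivable_pt_lim_comp_2d; [apply Df| |];
  apply is_derive_Reals; [apply DX|apply DY]; lia.
Qed.

(** * Infinitesimal change of the frame *)

Definition ray (a : R) (k : nat) : R := match k with 1 => a | _ => 0 end.

Definition normal_derivatives (c : curvatures) (p : nat -> nat -> R) : Prop :=
  (p 1%nat 0%nat = 0 /\ p 0%nat 1%nat = 0) /\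
  (p 2%nat 0%nat = 1 /\ p 1%nat 1%nat = 0 /\ p 0%nat 2%nat = 1) /\
  (p 3%nat 0%nat = 1 /\ p 2%nat 1%nat = 0 /\ p 1%nat 2%nat = - 1 /\ p 0%nat 3%nat = 0) /\
  c = (p 4%nat 0%nat, p 3%nat 1%nat, p 2%nat 2%nat, p 1%nat 3%nat, p 0%nat 4%nat).

(** The derivatives at r = 0 of g (a r) (b r), for g with the normalized 4-jet of quartic part c;
    the factorials cancel. *)
Definition normal_jet (c : curvatures) (a b : R) (k : nat) : R :=
  match k with
  | 2 => a ^ 2 + b ^ 2
  | 3 => a ^ 3 - 3 * a * b ^ 2
  | 4 => quartic_form c (a, b)
  | _ => 0
  end.

(** The jet at r = 0 of one old coordinate along the curve (a r, b r, g (a r) (b r)) given in the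
    new frame, m being the corresponding row of the transition matrix. *)
Definition row_jet (c : curvatures) (a b : R) (m : nat -> R) (k : nat) : R :=
  ray a k * m 1%nat + ray b k * m 2%nat + normal_jet c a b k * m 3%nat.

(** The derivatives, at the identity matrix, of the jet comparisons of orders 2, 3 and 4. The pair
    (al, be) is the first variation of the direction (a, b). *)
Definition variation_identities (c : curvatures) (p dp dm : nat -> nat -> R) : Prop :=
  forall a b,
    let al := a * dm 1%nat 1%nat + b * dm 1%nat 2%nat in
    let be := a * dm 2%nat 1%nat + b * dm 2%nat 2%nat in
    dp 2%nat 0%nat * a ^ 2 + 2 * dp 1%nat 1%nat * a * b + dp 0%nat 2%nat * b ^ 2
      + 2 * (a * al + b * be)
      = (a ^ 2 + b ^ 2) * dm 3%nat 3%nat /\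
    dp 3%nat 0%nat * a ^ 3 + 3 * dp 2%nat 1%nat * a ^ 2 * b
      + 3 * dp 1%nat 2%nat * a * b ^ 2 + dp 0%nat 3%nat * b ^ 3
      + 3 * ((a ^ 2 - b ^ 2) * al - 2 * a * b * be)
      + 3 * (a ^ 2 + b ^ 2) * (a * dm 1%nat 3%nat + b * dm 2%nat 3%nat)
      = (a ^ 3 - 3 * a * b ^ 2) * dm 3%nat 3%nat /\
    dp 4%nat 0%nat * a ^ 4 + 4 * dp 3%nat 1%nat * a ^ 3 * b
      + 6 * dp 2%nat 2%nat * a ^ 2 * b ^ 2 + 4 * dp 1%nat 3%nat * a * b ^ 3
      + dp 0%nat 4%nat * b ^ 4
      + 4 * ((p 4%nat 0%nat * a ^ 3 + 3 * p 3%nat 1%nat * a ^ 2 * b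
              + 3 * p 2%nat 2%nat * a * b ^ 2 + p 1%nat 3%nat * b ^ 3) * al
             + (p 3%nat 1%nat * a ^ 3 + 3 * p 2%nat 2%nat * a ^ 2 * b
              + 3 * p 1%nat 3%nat * a * b ^ 2 + p 0%nat 4%nat * b ^ 3) * be)
      + 6 * (a ^ 2 + b ^ 2) * ((a ^ 2 - b ^ 2) * dm 1%nat 3%nat - 2 * a * b * dm 2%nat 3%nat)
      + 4 * (a ^ 3 - 3 * a * b ^ 2) * (a * dm 1%nat 3%nat + b * dm 2%nat 3%nat)
      = quartic_form c (a, b) * dm 3%nat 3%nat.

(** The curvatures c do not depend on s, so the right-hand side varies only through the third row of
    m. On the left, the identity matrix at s = 0 and the normalized values of p kill most terms of
    the product rule. *)
Lemma frame_variation (c : curvatures) (p : nat -> nat -> R -> R) (dp : nat -> nat -> R)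
    (m : nat -> nat -> R -> R) (dm : nat -> nat -> R) :
  (forall i j, is_derive (p i j) 0 (dp i j)) ->
  (forall i j, is_derive (m i j) 0 (dm i j)) ->
  (forall i j, (1 <= i <= 3)%nat -> (1 <= j <= 3)%nat ->
    m i j 0 = if Nat.eqb i j then 1 else 0) ->
  normal_derivatives c (fun i j => p i j 0) ->
  locally 0 (fun s => forall a b k, (1 <= k <= 4)%nat ->
    faa_di_bruno k (fun i j => p i j s) (row_jet c a b (fun j => m 1%nat j s))
      (row_jet c a b (fun j => m 2%nat j s)) = row_jet c a b (fun j => m 3%nat j s) k) ->
  variation_identities c (fun i j => p i j 0) dp dm.
Proof.
intros Hp Hm Hm0 ((N10 & N01) & (N20 & N11 & N02) & (N30 & N21 & N12 & N03) & _) Hloc a b al be.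
unfold al, be; clear al be.
assert (Dp : forall i j, Derive (fun s => p i j s) 0 = dp i j)
  by (intros; apply is_derive_unique, Hp).
assert (Dm : forall i j, Derive (fun s => m i j s) 0 = dm i j)
  by (intros; apply is_derive_unique, Hm).
assert (Ep : forall i j, ex_derive (fun s => p i j s) 0) by (intros; eexists; apply Hp).
assert (Em : forall i j, ex_derive (fun s => m i j s) 0) by (intros; eexists; apply Hm).
assert (M11 := Hm0 1%nat 1%nat ltac:(lia) ltac:(lia)); cbn in M11.
assert (M12 := Hm0 1%nat 2%nat ltac:(lia) ltac:(lia)); cbn in M12.
assert (M13 := Hm0 1%nat 3%nat ltac:(lia) ltac:(lia)); cbn in M13.
assert (M21 := Hm0 2%nat 1%nat ltac:(lia) ltac:(lia)); cbn in M21.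
assert (M22 := Hm0 2%nat 2%nat ltac:(lia) ltac:(lia)); cbn in M22.
assert (M23 := Hm0 2%nat 3%nat ltac:(lia) ltac:(lia)); cbn in M23.
set (L k s := faa_di_bruno k (fun i j => p i j s) (row_jet c a b (fun j => m 1%nat j s))
      (row_jet c a b (fun j => m 2%nat j s))).
assert (K : forall k (v : R), (2 <= k <= 4)%nat -> is_derive (L k) 0 v ->
  v = normal_jet c a b k * dm 3%nat 3%nat).
{ intros k v Hk HL.
  apply (is_derive_locally_eq (L k) (fun s => row_jet c a b (fun j => m 3%nat j s) k) 0);
    [|exact HL|].
  - generalize Hloc; apply filter_imp; intros s Hs; apply Hs; lia.
  - clear L HL Hloc; destruct k as [|[|k]]; [lia|lia|].
    unfold row_jet, ray; generalize (normal_jet c a b (S (S k))); intros q; auto_derive.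
    + repeat apply conj; exact I || apply Em.
    + rewrite ?Dm; ring. }
split; [|split]; [apply (K 2%nat)|apply (K 3%nat)|apply (K 4%nat)]; try lia; clear K Hloc;
  unfold L, faa_di_bruno, row_jet, ray, normal_jet; generalize (quartic_form c (a, b)); intros q;
  auto_derive;
  repeat match goal with
  | |- _ /\ _ => split
  | |- True => exact I
  | |- ex_derive (fun _ => m _ _ _) _ => apply Em
  | |- ex_derive (fun _ => p _ _ _) _ => apply Ep
  end;
  rewrite ?Dm, ?Dp, ?M11, ?M12, ?M13, ?M21, ?M22, ?M23;
  rewrite ?N10, ?N01, ?N20, ?N11, ?N02, ?N30, ?N21, ?N12, ?N03; ring.
Qed.

(** A and B are the derivatives of the frame matrix in the two coordinate directions. Both families
    of identities speak of the same fifth derivatives of f, whence the constraints. *)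
Lemma curvature_equations (a b c d e : R) (p A B : nat -> nat -> R) :
  normal_derivatives (a, b, c, d, e) p ->
  variation_identities (a, b, c, d, e) p (fun i j => p (S i) j) A ->
  variation_identities (a, b, c, d, e) p (fun i j => p i (S j)) B ->
  3 * a * b - 15 * b * c + 3 * c * d + 17 * a * d - 4 * b * e - 36 * d = 0 /\
  - 9 * c ^ 2 + 3 * a * c + 10 * b * d + 2 * d ^ 2 - 3 * c * e + a * e + 18 * c + 6 * e = 0 /\
  3 * c * d + 6 * a * d - 3 * b * c - b * e - d * e - 12 * d = 0 /\
  - 12 * c * e + 6 * a * e + 6 * b * d + 14 * d ^ 2 - 18 * a + 18 * c - 9 * c ^ 2 - e ^ 2 = 0.
Proof.
intros (_ & (N20 & N11 & N02) & (N30 & N21 & N12 & N03) & N4) HA HB.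
injection N4 as N40 N31 N22 N13 N04.
(* A binary form of degree n is determined by its values at n + 1 pairwise independent vectors:
   three for order 2, four for order 3, five for order 4. *)
destruct (HA 1 0) as (A2 & A3 & A4), (HA 0 1) as (A2' & A3' & A4'),
  (HA 1 1) as (A2'' & A3'' & A4''), (HA 1 (-1)) as (_ & A3m & A4m), (HA 2 1) as (_ & _ & A4l).
destruct (HB 1 0) as (B2 & B3 & B4), (HB 0 1) as (B2' & B3' & B4'),
  (HB 1 1) as (B2'' & B3'' & B4''), (HB 1 (-1)) as (_ & B3m & B4m), (HB 2 1) as (_ & _ & B4l).
clear HA HB.
unfold quartic_form in *.
rewrite ?N20, ?N11, ?N02, ?N30, ?N21, ?N12, ?N03, <- ?N40, <- ?N31, <- ?N22, <- ?N13, <- ?N04 in *.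
clear N20 N11 N02 N30 N21 N12 N03 N40 N31 N22 N13 N04.
(* Orders 2 and 3 give seven linear equations for the seven entries of A, and likewise for B. *)
assert (EA33 : A 3%nat 3%nat = (3 * c - a) / 2) by lra.
assert (EA11 : A 1%nat 1%nat = ((3 * c - a) / 2 - 1) / 2) by lra.
assert (EA22 : A 2%nat 2%nat = ((3 * c - a) / 2 + 1) / 2) by lra.
assert (EA21 : A 2%nat 1%nat = (3 * b - d) / 12) by lra.
assert (EA12 : A 1%nat 2%nat = - ((3 * b - d) / 12)) by lra.
assert (EA13 : A 1%nat 3%nat = (2 - a - c) / 4) by lra.
assert (EA23 : A 2%nat 3%nat = - (b + d) / 4) by lra.
assert (EB33 : B 3%nat 3%nat = (3 * d - b) / 2) by lra.
assert (EB11 : B 1%nat 1%nat = (3 * d - b) / 4) by lra.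
assert (EB22 : B 2%nat 2%nat = (3 * d - b) / 4) by lra.
assert (EB21 : B 2%nat 1%nat = (3 * c - e + 6) / 12) by lra.
assert (EB12 : B 1%nat 2%nat = 1 - (3 * c - e + 6) / 12) by lra.
assert (EB13 : B 1%nat 3%nat = - (b + d) / 4) by lra.
assert (EB23 : B 2%nat 3%nat = (2 - e - c) / 4) by lra.
clear A2 A2' A2'' A3 A3' A3'' A3m B2 B2' B2'' B3 B3' B3'' B3m.
rewrite EA33, EA11, EA22, EA21, EA12, EA13, EA23 in *.
rewrite EB33, EB11, EB22, EB21, EB12, EB13, EB23 in *.
clear EA33 EA11 EA22 EA21 EA12 EA13 EA23 EB33 EB11 EB22 EB21 EB12 EB13 EB23.
(* Order 4 leaves ten equations, linear in the six fifth derivatives; eliminating these yields four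
   relations. *)
repeat split; lra.
Qed.
(** Restrict the identity between the two graphs to the line (u, v) = (a r, b r) and compare
    derivatives of orders 1 to 4 at r = 0. The normalization of g makes its contribution depend on c
    alone. *)
Lemma transition_jet (c : curvatures) (f g : R -> R -> R) (m : nat -> nat -> R) (s t : R) :
  smooth_near f s t -> smooth_near g 0 0 ->
  g 0 0 = 0 -> normal_derivatives c (fun i j => partial_derive i j g 0 0) ->
  locally_2d (fun u v =>
    f s t + (u * m 3%nat 1%nat + v * m 3%nat 2%nat + g u v * m 3%nat 3%nat) =
    f (s + (u * m 1%nat 1%nat + v * m 1%nat 2%nat + g u v * m 1%nat 3%nat))
      (t + (u * m 2%nat 1%nat + v * m 2%nat 2%nat + g u v * m 2%nat 3%nat))) 0 0 ->
  forall a b k, (1 <= k <= 4)%nat ->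
    faa_di_bruno k (fun i j => partial_derive i j f s t)
      (row_jet c a b (m 1%nat)) (row_jet c a b (m 2%nat)) = row_jet c a b (m 3%nat) k.
Proof.
intros Hf Hg G0 N Hloc a b k Hk.
apply smooth_near_differentiable in Hf; apply smooth_near_differentiable in Hg.
set (W := composed_jet g (ray_jet a) (ray_jet b)).
assert (HR : forall a', locally 0 (fun s => forall i, (i < 4)%nat ->
   is_derive (ray_jet a' i) s (ray_jet a' (S i) s))).
{ intros a'; apply filter_forall; intros; apply is_derive_ray_jet. }
assert (R0 : forall a', ray_jet a' 0 0 = 0) by (intros; unfold ray_jet; ring).
assert (DW : locally 0 (fun s => forall i, (i < 4)%nat -> is_derive (W i) s (W (S i) s))).
{ apply is_derive_composed_jet; [|apply HR|apply HR].
  rewrite !R0; exact Hg. }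
assert (W0 : forall i, (1 <= i <= 4)%nat -> W i 0 = normal_jet c a b i).
{ destruct N as ((N10 & N01) & (N20 & N11 & N02) & (N30 & N21 & N12 & N03) & ->).
  intros [|[|[|[|[|i]]]]] Hi; try lia;
  unfold W, composed_jet, faa_di_bruno, normal_jet, quartic_form; rewrite !R0;
  unfold ray_jet; rewrite ?N10, ?N01, ?N20, ?N11, ?N02, ?N30, ?N21, ?N12, ?N03; ring. }
(* [X z l i] is the i-th derivative of z plus the l-th old coordinate, so z survives only in order
   0. *)
set (X (z : R) (l : nat) (i : nat) (r : R) := (match i with 0 => z | _ => 0 end)
  + (ray_jet a i r * m l 1%nat + ray_jet b i r * m l 2%nat + W i r * m l 3%nat)).
assert (DX : forall z l, locally 0 (fun r => forall i, (i < 4)%nat ->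
   is_derive (X z l i) r (X z l (S i) r))).
{ intros z l; generalize DW; apply filter_imp; intros r Dr i Hi.
  specialize (Dr i Hi).
  assert (Da := is_derive_ray_jet a i r); assert (Db := is_derive_ray_jet b i r).
  unfold X; simpl (match S i with 0 => z | _ => 0 end).
  generalize (match i with 0 => z | _ => 0 end); intros z'.
  auto_derive.
  - repeat split; eexists; eassumption.
  - rewrite (is_derive_unique (fun x : R => ray_jet a i x) _ _ Da).
    rewrite (is_derive_unique (fun x : R => ray_jet b i x) _ _ Db).
    rewrite (is_derive_unique (fun x : R => W i x) _ _ Dr). ring. }
assert (W00 : W 0%nat 0 = 0).
{ unfold W, composed_jet, faa_di_bruno; rewrite !R0; exact G0. }
assert (X00 : forall z l, X z l 0%nat 0 = z).
{ intros z l; unfold X; rewrite !R0, W00; ring. }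
assert (Xi0 : forall z l i, (1 <= i <= 4)%nat -> X z l i 0 = row_jet c a b (m l) i).
{ intros z l i Hi; unfold X, row_jet; rewrite W0 by exact Hi.
  destruct i as [|[|i]]; [lia| |]; unfold ray_jet, ray; ring. }
transitivity (X (f s t) 3%nat k 0); [|apply Xi0; exact Hk].
transitivity (composed_jet f (X s 1%nat) (X t 2%nat) k 0).
- unfold composed_jet; rewrite !X00.
  destruct k as [|[|[|[|[|k]]]]]; try lia; unfold faa_di_bruno; rewrite !Xi0 by lia; reflexivity.
- apply (derivative_sequences_agree _ _ 4); [|apply DX| |lia].
  + apply is_derive_composed_jet; [rewrite !X00; exact Hf|apply DX|apply DX].
  + assert (C : forall a', continuous (ray_jet a' 0%nat) 0).
    { intros a'; apply @ex_derive_continuous; eexists; apply is_derive_ray_jet. }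
    match type of Hloc with locally_2d ?P _ _ =>
      assert (L : locally 0 (fun r => P (ray_jet a 0 r) (ray_jet b 0 r)))
        by (apply (locally_2d_pullback P); [rewrite !R0; exact Hloc|apply C|apply C]) end.
    generalize L; apply filter_imp; intros r Hr; symmetry; exact Hr.
Qed.

(** * From the surface to jets *)

Lemma adapted_normal_derivatives S P e f :
  adapted S P e f ->
  f 0 0 = 0 /\ normal_derivatives (taylor_curvatures f) (fun i j => partial_derive i j f 0 0).
Proof.
intros [_ H].
set (D := fun m k => partial_derive m k f 0 0).
assert (E : forall x y, D 0%nat 0%nat + (D 0%nat 1%nat * y + D 1%nat 0%nat * x)
  + 1 / 2 * (D 0%nat 2%nat * y ^ 2 + 2 * D 1%nat 1%nat * x * y + D 2%nat 0%nat * x ^ 2)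
  + 1 / 6 * (D 0%nat 3%nat * y ^ 3 + 3 * D 1%nat 2%nat * x * y ^ 2
     + 3 * D 2%nat 1%nat * x ^ 2 * y + D 3%nat 0%nat * x ^ 3)
  = 1 / 2 * (x ^ 2 + y ^ 2) + 1 / 6 * (x ^ 3 - 3 * x * y ^ 2)).
{ intros x y; rewrite <- (H x y); unfold DL_pol, differential.
  change (partial_derive ?m ?k f 0 0) with (D m k).
  unfold sum_f_R0, Binomial.C; simpl; unfold D; field. }
assert (F : f 0 0 = D 0%nat 0%nat) by reflexivity.
rewrite F; unfold normal_derivatives, taylor_curvatures.
change (partial_derive ?m ?k f 0 0) with (D m k).
clearbody D.
(* Ten points at which a bivariate polynomial of degree at most 3 is determined by its values. *)
assert (E1 := E 0 0); assert (E2 := E 1 0); assert (E3 := E (-1) 0); assert (E4 := E 2 0).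
assert (E5 := E 0 1); assert (E6 := E 0 (-1)); assert (E7 := E 0 2).
assert (E8 := E 1 1); assert (E9 := E 1 (-1)); assert (E10 := E 2 1).
repeat split; lra.
Qed.

Definition dot (l v : space) : R :=
  fst (fst l) * fst (fst v) + snd (fst l) * snd (fst v) + snd l * snd v.

Definition frame_vector (e : frame) (j : nat) : space :=
  match j with 1 => e1 e | 2 => e2 e | _ => e3 e end.

Lemma space_eq (a b c a' b' c' : R) :
  a = a' -> b = b' -> c = c' -> (a, b, c) = (a', b', c').
Proof. congruence. Qed.

Lemma lin_comb_components (e : frame) (x y z : R) :
  lin_comb e x y z =
  (x * fst (fst (e1 e)) + y * fst (fst (e2 e)) + z * fst (fst (e3 e)),
   x * snd (fst (e1 e)) + y * snd (fst (e2 e)) + z * snd (fst (e3 e)),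
   x * snd (e1 e) + y * snd (e2 e) + z * snd (e3 e)).
Proof. reflexivity. Qed.

Lemma affine_point_components (P : space) (e : frame) (x y z : R) :
  affine_point P e x y z =
  (fst (fst P) + fst (fst (lin_comb e x y z)),
   snd (fst P) + snd (fst (lin_comb e x y z)), snd P + snd (lin_comb e x y z)).
Proof. reflexivity. Qed.

Lemma affine_point_origin (P : space) (e : frame) : affine_point P e 0 0 0 = P.
Proof.
rewrite affine_point_components, lin_comb_components; destruct P as [[a b] c]; cbn [fst snd].
apply space_eq; ring.
Qed.

(** Expanding the standard basis in e gives the columns of the inverse matrix, whose rows are the
    forms [l i]. With fixed forms, the transition matrix depends linearly on the moving vectors and
    inherits their derivatives. *)
Lemma dual_basis (e : frame) :
  is_basis e -> exists l : nat -> space,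
    (forall v, v = lin_comb e (dot (l 1%nat) v) (dot (l 2%nat) v) (dot (l 3%nat) v)) /\
    forall i j, (1 <= i <= 3)%nat -> (1 <= j <= 3)%nat ->
      dot (l i) (frame_vector e j) = if Nat.eqb i j then 1 else 0.
Proof.
intros He.
destruct (He (1, 0, 0)) as [[[x1 y1] z1] [H1 _]].
destruct (He (0, 1, 0)) as [[[x2 y2] z2] [H2 _]].
destruct (He (0, 0, 1)) as [[[x3 y3] z3] [H3 _]].
exists (fun i => match i with 1 => (x1, x2, x3) | 2 => (y1, y2, y3) | _ => (z1, z2, z3) end).
cbv beta iota.
set (lx := (x1, x2, x3)); set (ly := (y1, y2, y3)); set (lz := (z1, z2, z3)).
assert (K : forall v, v = lin_comb e (dot lx v) (dot ly v) (dot lz v)).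
{ rewrite lin_comb_components in H1, H2, H3.
  injection H1 as H11 H12 H13; injection H2 as H21 H22 H23; injection H3 as H31 H32 H33.
  intros [[a b] c]; rewrite lin_comb_components; unfold dot, lx, ly, lz; cbn [fst snd].
  apply (f_equal (Rmult a)) in H11, H12, H13; apply (f_equal (Rmult b)) in H21, H22, H23;
  apply (f_equal (Rmult c)) in H31, H32, H33.
  apply space_eq; lra. }
split; [exact K|].
assert (U : forall v x y z, v = lin_comb e x y z -> dot lx v = x /\ dot ly v = y /\ dot lz v = z).
{ intros v x y z Hv; destruct (He v) as [q [_ Hq]].
  assert (E : (dot lx v, dot ly v, dot lz v) = (x, y, z)).
  { transitivity q; [symmetry; apply Hq, K|apply Hq, Hv]. }
  now injection E as -> -> ->. }
assert (U1 : e1 e = lin_comb e 1 0 0).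
{ rewrite lin_comb_components; destruct (e1 e) as [[a b] c]; cbn [fst snd]; apply space_eq; ring. }
assert (U2 : e2 e = lin_comb e 0 1 0).
{ rewrite lin_comb_components; destruct (e2 e) as [[a b] c]; cbn [fst snd]; apply space_eq; ring. }
assert (U3 : e3 e = lin_comb e 0 0 1).
{ rewrite lin_comb_components; destruct (e3 e) as [[a b] c]; cbn [fst snd]; apply space_eq; ring. }
apply U in U1, U2, U3.
intros [|[|[|[|i]]]] [|[|[|[|j]]]] Hi Hj; try lia; cbn [frame_vector Nat.eqb]; tauto.
Qed.

Lemma locally_2d_pullback3 (W : R * R * R -> Prop) (X Y Z : R -> R -> R) (x y : R) :
  locally (X x y, Y x y, Z x y) W ->
  continuity_2d_pt X x y -> continuity_2d_pt Y x y -> continuity_2d_pt Z x y ->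
  locally_2d (fun u v => W (X u v, Y u v, Z u v)) x y.
Proof.
intros [eps H] HX HY HZ.
apply locally_2d_impl with
  (2 := locally_2d_and _ _ _ _ (HX eps) (locally_2d_and _ _ _ _ (HY eps) (HZ eps))).
apply locally_2d_forall; intros u v (Bx & By & Bz).
apply H; repeat split; assumption.
Qed.

Ltac continuity_2d :=
  repeat first
    [ apply continuity_2d_pt_id1 | apply continuity_2d_pt_id2 | apply continuity_2d_pt_const
    | assumption | apply continuity_2d_pt_plus | apply continuity_2d_pt_mult ].

Lemma smooth_near_continuity (f : R -> R -> R) (x y : R) :
  smooth_near f x y -> continuity_2d_pt f x y.
Proof. intros H; exact (proj1 (locally_2d_singleton _ _ _ H 1%nat)). Qed.

Lemma affine_point_change (P : space) (e e' : frame) (l : nat -> space) (x y z u v w : R) :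
  (forall v, v = lin_comb e (dot (l 1%nat) v) (dot (l 2%nat) v) (dot (l 3%nat) v)) ->
  let m i j := dot (l i) (frame_vector e' j) in
  let row i := u * m i 1%nat + v * m i 2%nat + w * m i 3%nat in
  affine_point (affine_point P e x y z) e' u v w =
  affine_point P e (x + row 1%nat) (y + row 2%nat) (z + row 3%nat).
Proof.
intros Hl m row.
assert (E1 := Hl (e1 e')); assert (E2 := Hl (e2 e')); assert (E3 := Hl (e3 e')).
change (e1 e') with (frame_vector e' 1) in E1 at 2 3 4.
change (e2 e') with (frame_vector e' 2) in E2 at 2 3 4.
change (e3 e') with (frame_vector e' 3) in E3 at 2 3 4.
fold (m 1%nat 1%nat) (m 2%nat 1%nat) (m 3%nat 1%nat) in E1.
fold (m 1%nat 2%nat) (m 2%nat 2%nat) (m 3%nat 2%nat) in E2.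
fold (m 1%nat 3%nat) (m 2%nat 3%nat) (m 3%nat 3%nat) in E3.
rewrite !affine_point_components, !lin_comb_components; cbn [fst snd].
rewrite E1, E2, E3, !lin_comb_components; cbn [fst snd]; unfold row.
apply space_eq; ring.
Qed.

(** Near Q the same set S is the graph of g in the frame e' and of f in the frame e. A point of the
    first graph, rewritten in old coordinates by [affine_point_change], therefore satisfies the
    equation of the second. *)
Lemma local_graph_transition S P e f l U :
  local_graph S P e f -> f 0 0 = 0 ->
  (forall v, v = lin_comb e (dot (l 1%nat) v) (dot (l 2%nat) v) (dot (l 3%nat) v)) ->
  open U -> U P ->
  locally_2d (fun s t =>
    let Q := affine_point P e s t (f s t) in
    S Q /\ U Q /\ smooth_near f s t /\
    forall e' g, local_graph S Q e' g -> g 0 0 = 0 ->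
      let m i j := dot (l i) (frame_vector e' j) in
      locally_2d (fun u v =>
        f s t + (u * m 3%nat 1%nat + v * m 3%nat 2%nat + g u v * m 3%nat 3%nat) =
        f (s + (u * m 1%nat 1%nat + v * m 1%nat 2%nat + g u v * m 1%nat 3%nat))
          (t + (u * m 2%nat 1%nat + v * m 2%nat 2%nat + g u v * m 2%nat 3%nat))) 0 0) 0 0.
Proof.
intros (_ & Hf & HS) F0 Hl HU UP.
assert (Cf := smooth_near_continuity _ _ _ Hf).
assert (P0 : affine_point P e 0 0 (f 0 0) = P).
{ rewrite F0; apply affine_point_origin. }
assert (LU : locally_2d (fun s t => U (affine_point P e s t (f s t))) 0 0).
{ apply (locally_2d_pullback3 U
    (fun s t => fst (fst (affine_point P e s t (f s t))))
    (fun s t => snd (fst (affine_point P e s t (f s t))))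
    (fun s t => snd (affine_point P e s t (f s t)))).
  - change (locally (affine_point P e 0 0 (f 0 0)) U); rewrite P0; apply HU, UP.
  - apply (continuity_2d_pt_ext (fun s t => fst (fst P) +
      (s * fst (fst (e1 e)) + t * fst (fst (e2 e)) + f s t * fst (fst (e3 e)))));
    [reflexivity|continuity_2d].
  - apply (continuity_2d_pt_ext (fun s t => snd (fst P) +
      (s * snd (fst (e1 e)) + t * snd (fst (e2 e)) + f s t * snd (fst (e3 e)))));
    [reflexivity|continuity_2d].
  - apply (continuity_2d_pt_ext (fun s t => snd P +
      (s * snd (e1 e) + t * snd (e2 e) + f s t * snd (e3 e))));
    [reflexivity|continuity_2d]. }
(* The centre becomes (0, 0, f 0 0), so that the equivalence can be pulled back along the graph;
   [locally_locally] then recentres it at nearby points of S. *)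
rewrite <- F0 in HS at 3.
assert (LS := locally_2d_pullback3 _ (fun s t => s) (fun s t => t) f 0 0
  (locally_locally _ _ HS) (continuity_2d_pt_id1 0 0) (continuity_2d_pt_id2 0 0) Cf).
cbv beta in LS.
apply locally_2d_impl_strong with (2 := Hf); apply locally_2d_impl with (2 := LS).
apply locally_2d_impl with (2 := LU); apply locally_2d_forall.
intros s t Us Ls Hs Q.
split; [apply (locally_singleton _ _ Ls); reflexivity|].
split; [exact Us|].
split; [exact Hs|].
intros e' g (_ & Hg & HQ) G0 m.
assert (Cg := smooth_near_continuity _ _ _ Hg).
rewrite <- G0 in HQ at 3.
assert (LQ := locally_2d_pullback3 _ (fun s t => s) (fun s t => t) g 0 0
  HQ (continuity_2d_pt_id1 0 0) (continuity_2d_pt_id2 0 0) Cg).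
set (row i u v := u * m i 1%nat + v * m i 2%nat + g u v * m i 3%nat).
assert (LX : locally_2d (fun u v => (fun q : R * R * R =>
        let '(x, y, z) := q in S (affine_point P e x y z) <-> z = f x y)
     (s + row 1%nat u v, t + row 2%nat u v, f s t + row 3%nat u v)) 0 0).
{ assert (R0 : forall i, row i 0 0 = 0) by (intros i; unfold row; rewrite G0; ring).
  apply (locally_2d_pullback3 (fun q => let '(x, y, z) := q in
      S (affine_point P e x y z) <-> z = f x y) (fun u v => s + row 1%nat u v)
    (fun u v => t + row 2%nat u v) (fun u v => f s t + row 3%nat u v)); [rewrite !R0, !Rplus_0_r; exact Ls| | |];
  unfold row; continuity_2d. }
apply locally_2d_impl with (2 := LX); apply locally_2d_impl with (2 := LQ).
apply locally_2d_forall; intros u v [_ H1] [H2 _].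
unfold Q in H1; rewrite (affine_point_change _ _ _ l) in H1 by exact Hl.
exact (H2 (H1 eq_refl)).
Qed.

Lemma ex_derive_dot (l : space) (F : R -> space) (x : R) :
  ex_derive (fun s => fst (fst (F s))) x -> ex_derive (fun s => snd (fst (F s))) x ->
  ex_derive (fun s => snd (F s)) x -> ex_derive (fun s => dot l (F s)) x.
Proof.
intros [d1 H1] [d2 H2] [d3 H3].
exists (fst (fst l) * d1 + snd (fst l) * d2 + snd l * d3).
apply (is_derive_plus (fun s => fst (fst l) * fst (fst (F s)) + snd (fst l) * snd (fst (F s)))
  (fun s => snd l * snd (F s))).
- apply (is_derive_plus (fun s => fst (fst l) * fst (fst (F s)))
    (fun s => snd (fst l) * snd (fst (F s))));
  apply is_derive_scal; assumption.
- apply is_derive_scal; assumption.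
Qed.

Lemma ex_derive_dot_frame S U F P e f l :
  smooth_vector_on S U F -> S P -> U P -> local_graph S P e f ->
  ex_derive (fun s => dot l (F (affine_point P e s 0 (f s 0)))) 0 /\
  ex_derive (fun t => dot l (F (affine_point P e 0 t (f 0 t)))) 0.
Proof.
intros (H1 & H2 & H3) HP UP G.
destruct (locally_2d_singleton _ _ _ (H1 P HP UP e f G) 1%nat) as (_ & X1 & Y1 & _).
destruct (locally_2d_singleton _ _ _ (H2 P HP UP e f G) 1%nat) as (_ & X2 & Y2 & _).
destruct (locally_2d_singleton _ _ _ (H3 P HP UP e f G) 1%nat) as (_ & X3 & Y3 & _).
split; apply ex_derive_dot; assumption.
Qed.

Theorem theorem5p2 :
  forall (S : space -> Prop) (c : curvatures),
    regular_elliptical S ->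
    constant_curvatures S c ->
    exists c' : curvatures, D3_equiv c c' /\
      ((exists k : R, c' = curvA1 k \/ c' = curvA2 k \/ c' = curvA3 k) \/
       (exists k l : R, l * (2 * k - 3) > 0 /\ c' = curvB k l) \/
       (exists k : R, 0 < k < 3 /\ c' = curvC k)).
Proof.
intros S c [[[P HP] _] _] Hc; change (classified c).
destruct (Hc P HP) as (U & HU & UP & E & (_ & S1 & S2 & S3) & HC); clear Hc.
destruct (HC P HP UP) as (f & Ad & Ec).
destruct (adapted_normal_derivatives _ _ _ _ Ad) as [F0 N]; rewrite <- Ec in N.
destruct Ad as [G _].
destruct (dual_basis _ (proj1 G)) as (l & Hl & Hl0).
set (Q s t := affine_point P (E P) s t (f s t)).
(* Column j holds the coordinates, in the frame at P, of the j-th moving vector at [Q s t]. *)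
set (m i j s t := dot (l i) (frame_vector (E (Q s t)) j)).
assert (Q0 : Q 0 0 = P) by (unfold Q; rewrite F0; apply affine_point_origin).
assert (m0 : forall i j, (1 <= i <= 3)%nat -> (1 <= j <= 3)%nat ->
  m i j 0 0 = if Nat.eqb i j then 1 else 0).
{ intros i j Hi Hj; unfold m; rewrite Q0; apply Hl0; assumption. }
assert (Dm : forall i j, ex_derive (fun s => m i j s 0) 0 /\ ex_derive (fun t => m i j 0 t) 0).
(* [frame_vector] also sends the index 0 to the third vector, hence four cases. *)
{ intros i [|[|[|j]]]; unfold m, frame_vector, Q.
  - exact (ex_derive_dot_frame _ _ _ _ _ _ (l i) S3 HP UP G).
  - exact (ex_derive_dot_frame _ _ _ _ _ _ (l i) S1 HP UP G).
  - exact (ex_derive_dot_frame _ _ _ _ _ _ (l i) S2 HP UP G).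
  - exact (ex_derive_dot_frame _ _ _ _ _ _ (l i) S3 HP UP G). }
assert (J : locally_2d (fun s t => forall a b k, (1 <= k <= 4)%nat ->
   faa_di_bruno k (fun i j => partial_derive i j f s t)
     (row_jet c a b (fun j => m 1%nat j s t)) (row_jet c a b (fun j => m 2%nat j s t))
   = row_jet c a b (fun j => m 3%nat j s t) k) 0 0).
{ apply locally_2d_impl with (2 := local_graph_transition S P (E P) f l U G F0 Hl HU UP).
  apply locally_2d_forall; intros s t (SQ & UQ & Hf & HT) a b k Hk.
  (* Constancy enters here: the graph at [Q s t] has the same curvatures c as the one at P. *)
  destruct (HC (Q s t) SQ UQ) as (g & Ag & Eg).
  destruct (adapted_normal_derivatives _ _ _ _ Ag) as [G0 Ng]; rewrite <- Eg in Ng.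
  exact (transition_jet c f g (fun i j => m i j s t) s t Hf (proj1 (proj2 (proj1 Ag))) G0 Ng
    (HT _ _ (proj1 Ag) G0) a b k Hk). }
assert (Df := locally_2d_singleton _ _ _ (smooth_near_differentiable f 0 0 (proj1 (proj2 G)))).
(* Restricting the jet identities to the two coordinate axes gives the variations in s and in t. *)
assert (VX := frame_variation c (fun i j s => partial_derive i j f s 0)
  (fun i j => partial_derive (Datatypes.S i) j f 0 0) (fun i j s => m i j s 0)
  (fun i j => Derive (fun s => m i j s 0) 0)
  (fun i j => is_derive_partial_x _ _ _ _ _ (Df i j))
  (fun i j => Derive_correct _ _ (proj1 (Dm i j))) m0 N
  (locally_2d_1d_const_y _ _ _ J)).
assert (VY := frame_variation c (fun i j t => partial_derive i j f 0 t)
  (fun i j => partial_derive i (Datatypes.S j) f 0 0) (fun i j t => m i j 0 t)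
  (fun i j => Derive (fun t => m i j 0 t) 0)
  (fun i j => is_derive_partial_y _ _ _ _ _ (Df i j))
  (fun i j => Derive_correct _ _ (proj2 (Dm i j))) m0 N
  (locally_2d_1d_const_x _ _ _ J)).
clear - N VX VY; destruct c as [[[[i40 i31] i22] i13] i04].
destruct (curvature_equations _ _ _ _ _ _ _ _ N VX VY) as (E1 & E2 & E3 & E4).
now apply classified_of_compat.
Qed.
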